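(* Consider the transition kernels $q_{k+1}(u,\cdot)$, $k\ge 0$, of the filtering distributions $\mu_k$ of the conditionally Gaussian model (see context), where the observational data used to define the filtering distribution is the fixed data $\{y^\dagger_k\}_{k\ge1}$, so that $q_{k+1}(u,\cdot)$ is viewed as a random measure, parameterized by the random observational data. Then there is a probability measure $\mathbb{Q}$ on $\mathcal{X}$ and a sequence of random constants $\epsilon_k>0$, defined by the observational data, such that, for all $k\ge0$, all $u\in\mathcal{X}$ and all Borel sets $A\subset\mathcal{X}$, $$q_{k+1}(u,A)\ \ge\ \epsilon_k\,\mathbb{Q}(A).$$
   Context: $\mathcal{X}$ and $\mathcal{Y}$ are finite-dimensional Euclidean spaces. For a symmetric positive definite matrix $A$, $|\cdot|_A=|A^{-1/2}\cdot|$, where $|\cdot|$ is the Euclidean norm. Model. $\psi:\mathcal{X}\to\mathcal{X}$ is bounded (and measurable), $H:\mathcal{X}\to\mathcal{Y}$ is linear, and $$u_{k+1}=\psi(u_k)+\xi_k,\qquad y_{k+1}=Hu_{k+1}+\eta_{k+1},$$ with $u_0\sim\mu_0$ (a probability measure on $\mathcal{X}$), $\xi_k\sim N(0,\Sigma)$ i.i.d., $\eta_k\sim N(0,\Gamma)$ i.i.d., and $u_0,\{\xi_k\},\{\eta_k\}$ independent. Here $\Sigma=\sigma^2\Sigma_0$, $\Gamma=\gamma^2\Gamma_0$ with $\Sigma_0,\Gamma_0$ strictly positive definite, $\sigma,\gamma\in(0,\infty)$, and $r:=\sigma/\gamma$. Fixed data. Fix $u_0^\dagger\in\mathcal{X}$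 and positive semi-definite matrices $\Sigma_*,\Gamma_*$ on $\mathcal{X},\mathcal{Y}$. The true signal and data are realizations of $$u^\dagger_{k+1}=\psi(u^\dagger_k)+r\gamma\,\xi^\dagger_k,\qquad y^\dagger_{k+1}=Hu^\dagger_{k+1}+\gamma\,\eta^\dagger_{k+1},$$ with $\xi^\dagger_k\sim N(0,\Sigma_* )$ i.i.d., $\eta^\dagger_k\sim N(0,\Gamma_* )$ i.i.d., the two sequences being independent. Filtering distributions and kernels. Given data $\{y_k\}$ (here $y_k=y_k^\dagger$), define $$q^0_{k+1}(u,v)=\exp\Bigl(-\tfrac12|y_{k+1}-Hv|_\Gamma^2-\tfrac12|v-\psi(u)|_\Sigma^2\Bigr),\quad Z_{k+1}=\int_{\mathcal{X}}\int_{\mathcal{X}}q^0_{k+1}(u,v)\,dv\,\mu_k(du),$$ $$q_{k+1}(u,dv)=\frac{1}{Z_{k+1}}\,q^0_{k+1}(u,v)\,dv,\qquad \mu_{k+1}(A)=\int_{\mathcal{X}}q_{k+1}(u,A)\,\mu_k(du),$$ starting from $\mu_0$. Then $\mu_k$ is the filtering distribution, i.e. the conditional law of $u_k$ given $y_1,\dots,y_k$ under the model, evaluated at the given data. (Note that $q_{k+1}(u,\cdot)$ need not be a probability measure for each $u$, and $Z_{k+1}$ depends on the data and $\mu_k$.) *)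

(* Defs.v *)
From HB Require Import structures.
From mathcomp Require Import all_boot all_order all_algebra.
From mathcomp Require Import all_classical all_reals all_analysis.
From mathcomp Require Import measurable_realfun lra.

Set Implicit Arguments.
Unset Strict Implicit.
Unset Printing Implicit Defensive.

Import Order.TTheory GRing.Theory Num.Theory.
Import numFieldTopology.Exports numFieldNormedType.Exports.

Local Open Scope classical_set_scope.
Local Open Scope ring_scope.

Definition matrix_display : measure_display.
Proof. exact: default_measure_display. Qed.

Section borel_matrix.
Context {R : realType} (m n : nat).

Definition matrix_borel : set (set 'M[R]_(m, n)) := <<s open >>.

Let matrix_borel0 : matrix_borel set0.
Proof. exact: sigma_algebra0. Qed.

Let matrix_borelC A : matrix_borel A -> matrix_borel (~` A).
Proof. exact: sigma_algebraC. Qed.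

Let matrix_borel_bigcup (F : (set 'M[R]_(m, n))^nat) :
  (forall i, matrix_borel (F i)) -> matrix_borel (\bigcup_i F i).
Proof. exact: sigma_algebra_bigcup. Qed.

HB.instance Definition _ := @isMeasurable.Build matrix_display 'M[R]_(m, n)
  matrix_borel matrix_borel0 matrix_borelC matrix_borel_bigcup.

End borel_matrix.

Section borel_matrix_coord.
Context {R : realType} (m n : nat).

Lemma open_measurable_mx (U : set 'M[R]_(m, n)) : open U -> measurable U.
Proof. by move=> oU; exact: sub_sigma_algebra. Qed.

Lemma measurable_coord (i : 'I_m) (j : 'I_n) :
  measurable_fun [set: 'M[R]_(m, n)] (fun M => M i j : R).
Proof.
apply: (measurability _ (RGenOpens.measurableE R)) => _ [_ [a [b ->]] <-].
rewrite setTI; apply: open_measurable_mx.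
move: (@coord_continuous R m n i j) => /continuousP; apply.
exact: interval_open.
Qed.

Lemma measurable_fun_mxP d (T : measurableType d) (f : T -> 'M[R]_(m, n)) :
  (forall i j, measurable_fun setT (fun x => f x i j : R)) ->
  measurable_fun setT f.
Proof.
move=> mf.
pose box (c : 'M[rat]_(m, n)) (k : nat) : set 'M[R]_(m, n) :=
  [set M | forall i j, `|ratr (c i j) - M i j| < k.+1%:R^-1].
have mbox c k : measurable (f @^-1` box c k).
  have -> : f @^-1` box c k = \bigcap_(p in [set: 'I_m * 'I_n])
      ((fun x => f x p.1 p.2 : R) @^-1`
        [set y | `|ratr (c p.1 p.2) - y| < k.+1%:R^-1]).
    apply/seteqP; split=> x /=.
      by move=> xb [i j] _ /=; exact: xb.
    by move=> xb i j; exact: (xb (i, j)).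
  apply: fin_bigcap_measurable => // -[i j] _ /=.
  rewrite -[X in measurable X]setTI; apply: mf => //.
  apply: open_measurable.
  have -> : [set y : R | `|ratr (c i j) - y| < k.+1%:R^-1] =
            ball (ratr (c i j) : R) k.+1%:R^-1 by [].
  exact: ball_open.
apply: (@measurability _ _ _ _ setT f open erefl) => _ [U oU <-].
rewrite setTI.
have -> : f @^-1` U = \bigcup_(p in [set p : 'M[rat]_(m, n) * nat |
     box p.1 p.2 `<=` U]) (f @^-1` box p.1 p.2).
  apply/seteqP; split=> x /=; last by move=> [p pU xp]; exact: pU.
  move=> Ufx.
  have /nbhs_ballP[e /= e0 eU] : nbhs (f x) U by exact: open_nbhs_nbhs.
  have [k ke] : exists k : nat, k.+1%:R^-1 < e / 2.
    have e20 : 0 < e / 2 by rewrite divr_gt0.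
    exists (Num.truncn (e / 2)^-1).
    rewrite invf_plt ?posrE//.
    exact: truncnS_gt.
  have hc i j : {c : rat | `|ratr c - f x i j| < k.+1%:R^-1}.
    apply: cid.
    have k0 : 0 < k.+1%:R^-1 :> R by rewrite invr_gt0.
    have := @rat_in_itvoo R (f x i j - k.+1%:R^-1) (f x i j + k.+1%:R^-1).
    case; first by rewrite ltrD2l gtrN.
    move=> q; rewrite in_itv/= => /andP[q1 q2]; exists q.
    by rewrite ltr_distl q1 q2.
  exists (\matrix_(i, j) sval (hc i j), k) => /=; last first.
    by move=> i j; rewrite mxE; exact: svalP (hc i j).
  move=> M bM; apply: eU; split => // i j.
  have := bM i j; rewrite mxE => bMij.
  have := svalP (hc i j) => /= hcij.
  rewrite /ball/=.
  have -> : f x i j - M i j =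
    (ratr (sval (hc i j)) - M i j) - (ratr (sval (hc i j)) - f x i j) by lra.
  apply: (le_lt_trans (ler_normB _ _)).
  rewrite (splitr e); apply: ltrD; apply: (lt_trans _ ke) => //.
rewrite bigcup_mkcond; apply: countable_bigcupT_measurable => //.
by move=> p; case: ifP.
Qed.

End borel_matrix_coord.

Section lebesgue_cV.
Context {R : realType}.

Section step.
Variables (n : nat) (m : {sigma_finite_measure set 'cV[R]_n -> \bar R}).

Definition cons_cV (p : R * 'cV[R]_n) : 'cV[R]_n.+1 :=
  \col_i oapp (fun j => p.2 j 0) p.1 (unlift ord0 i).

Definition uncons_cV (x : 'cV[R]_n.+1) : R * 'cV[R]_n :=
  (x ord0 0, \col_j x (lift ord0 j) 0).

Lemma cons_cVK : cancel cons_cV uncons_cV.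
Proof.
move=> [a v]; congr pair; first by rewrite mxE unlift_none.
by apply/matrixP => i j; rewrite !mxE liftK (ord1 j).
Qed.

Lemma measurable_cons_cV : measurable_fun setT cons_cV.
Proof.
apply: measurable_fun_mxP => i j; under eq_fun do rewrite mxE.
case: (unlift ord0 i) => [k|] /=; last exact: measurable_fst.
apply: (measurableT_comp (measurable_coord k 0)); exact: measurable_snd.
Qed.

Lemma measurable_uncons_cV : measurable_fun setT uncons_cV.
Proof.
apply: measurable_fun_pair; first exact: measurable_coord.
apply: measurable_fun_mxP => i j; under eq_fun do rewrite mxE.
exact: measurable_coord.
Qed.

Definition lebesgue_cons : set 'cV[R]_n.+1 -> \bar R :=
  pushforward (product_measure1 (@lebesgue_measure R) m) cons_cV.

Let lebesgue_cons0 : lebesgue_cons set0 = 0%E.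
Proof. by rewrite /lebesgue_cons /pushforward preimage_set0 measure0. Qed.

Let lebesgue_cons_ge0 A : (0 <= lebesgue_cons A)%E.
Proof. by rewrite /lebesgue_cons /pushforward; exact: measure_ge0. Qed.

Let lebesgue_cons_sigma_additive : semi_sigma_additive lebesgue_cons.
Proof.
have mpre A : measurable A -> measurable (cons_cV @^-1` A).
  by move=> mA; rewrite -[X in measurable X]setTI; exact: measurable_cons_cV.
move=> F mF tF mUF; rewrite /lebesgue_cons /pushforward preimage_bigcup.
apply: measure_semi_sigma_additive.
- by move=> k; exact: mpre.
- apply/trivIsetP => /= i j _ _ ij; rewrite -preimage_setI.
  by move/trivIsetP : tF => /(_ _ _ _ _ ij) ->//; rewrite preimage_set0.
- by rewrite -preimage_bigcup; exact: mpre.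
Qed.

HB.instance Definition _ := isMeasure.Build _ _ _ lebesgue_cons
  lebesgue_cons0 lebesgue_cons_ge0 lebesgue_cons_sigma_additive.

Lemma lebesgue_cons_sigma_finite : sigma_finite setT lebesgue_cons.
Proof.
have /sigma_finiteP[F [TF ndF Foo]] := sigma_finiteT (@lebesgue_measure R).
have /sigma_finiteP[G [TG ndG Goo]] := sigma_finiteT m.
exists (fun k => uncons_cV @^-1` (F k `*` G k)).
  rewrite -preimage_bigcup -[LHS](preimage_setT uncons_cV); congr (_ @^-1` _).
  apply/esym/seteqP; split => // -[x y] _.
  have [a _ Fa] : (\bigcup_k F k) x by rewrite -TF.
  have [b _ Gb] : (\bigcup_k G k) y by rewrite -TG.
  exists (maxn a b) => //; split => /=.
    by move: x Fa {y Gb}; exact/subsetPset/ndF/leq_maxl.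
  by move: y Gb {x Fa}; exact/subsetPset/ndG/leq_maxr.
move=> k; have [mFk Fk] := Foo k; have [mGk Gk] := Goo k; split.
  rewrite -[X in measurable X]setTI; apply: measurable_uncons_cV => //.
  exact: measurableX.
rewrite /lebesgue_cons /pushforward.
have -> : cons_cV @^-1` (uncons_cV @^-1` (F k `*` G k)) = F k `*` G k.
  by rewrite -comp_preimage (_ : _ \o _ = id) //; apply/funext/cons_cVK.
by rewrite product_measure1E// lte_mul_pinfty// ge0_fin_numE.
Qed.

HB.instance Definition _ := @Measure_isSigmaFinite.Build _ _ _ lebesgue_cons
  lebesgue_cons_sigma_finite.

End step.

Fixpoint lebesgue_cV (n : nat) : {sigma_finite_measure set 'cV[R]_n -> \bar R} :=
  match n with
  | 0%N => \d_(0 : 'cV[R]_0)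
  | n'.+1 => lebesgue_cons (lebesgue_cV n')
  end.

End lebesgue_cV.

Section euclidean.
Context {R : realType}.

(* The norm `|x| that the library puts on matrices is the sup norm. *)
Definition enorm n (x : 'cV[R]_n) : R := Num.sqrt (\sum_(i < n) x i 0 ^+ 2).

Definition quadratic n (S : 'M[R]_n) (a : 'cV[R]_n) : R :=
  (a^T *m S *m a) 0 0.

Definition pos_semidef n (S : 'M[R]_n) : Prop :=
  S^T = S /\ forall a, 0 <= quadratic S a.

Definition pos_def n (S : 'M[R]_n) : Prop :=
  S^T = S /\ forall a, a != 0 -> 0 < quadratic S a.

(* The positive semi-definite square root; it exists and is unique when S is
   positive semi-definite, and is unspecified otherwise. *)
Definition mxsqrt n (S : 'M[R]_n) : 'M[R]_n :=
  xget 0 [set B | pos_semidef B /\ B *m B = S].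

(* |x|_S = |S^{-1/2} x|, meant for positive definite S. *)
Definition mnorm n (S : 'M[R]_n) (x : 'cV[R]_n) : R :=
  enorm (invmx (mxsqrt S) *m x).

End euclidean.

Section random_sequences.
Context d (T : measurableType d) (R : realType) (P : probability T R).

Definition sigma_rv d' (U : measurableType d') (X : T -> U) : set_system T :=
  preimage_set_system setT X measurable.

Definition sigma_seq d' (U : measurableType d') (X : nat -> T -> U) :
    set_system T :=
  <<s \bigcup_k sigma_rv (X k) >>.

Definition mutually_independent (F : nat -> set_system T) : Prop :=
  forall (J : seq nat) (E : nat -> set T), uniq J ->
    (forall j, j \in J -> F j (E j)) ->
    P (\bigcap_(j in [set` J]) E j) = (\prod_(j <- J) fine (P (E j)))%:E.

Definition independent2 (F G : set_system T) : Prop :=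
  forall A B, F A -> G B -> P (A `&` B) = (P A * P B)%E.

(* normal_prob is meaningful only for a nonzero standard deviation. *)
Definition centered_normal1 (v : R) : set R -> \bar R :=
  if v == 0 then \d_(0 : R) else normal_prob 0 (Num.sqrt v).

(* X ~ N(0, S), possibly degenerate: every linear functional a^T X is a real
   centered Gaussian variable of variance a^T S a. *)
Definition centered_normal n (X : T -> 'cV[R]_n) (S : 'M[R]_n) : Prop :=
  measurable_fun setT X /\
  forall (a : 'cV[R]_n) (A : set R), measurable A ->
    pushforward P (fun w => (a^T *m X w) 0 0) A =
    centered_normal1 (quadratic S a) A.

Definition iid_centered_normal n (X : nat -> T -> 'cV[R]_n) (S : 'M[R]_n) :
    Prop :=
  (forall k, centered_normal (X k) S) /\
  mutually_independent (fun k => sigma_rv (X k)).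

End random_sequences.

Section filtering.
Context {R : realType} (n m : nat).
Variables (psi : 'cV[R]_n -> 'cV[R]_n) (H : 'cV[R]_n -> 'cV[R]_m).
Variables (Sigma : 'M[R]_n) (Gamma : 'M[R]_m).

Definition q0 (y : 'cV[R]_m) (u v : 'cV[R]_n) : R :=
  expR (- (2^-1 * mnorm Gamma (y - H v) ^+ 2)
        - 2^-1 * mnorm Sigma (v - psi u) ^+ 2).

Definition Zconst (y : 'cV[R]_m) (mu : set 'cV[R]_n -> \bar R) : \bar R :=
  (\int[mu]_u \int[lebesgue_cV n]_v (q0 y u v)%:E)%E.

Definition qkernel (y : 'cV[R]_m) (mu : set 'cV[R]_n -> \bar R)
    (u : 'cV[R]_n) (A : set 'cV[R]_n) : \bar R :=
  ((Zconst y mu)^-1 * \int[lebesgue_cV n]_(v in A) (q0 y u v)%:E)%E.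

Fixpoint filter_distr (mu0 : set 'cV[R]_n -> \bar R) (y : nat -> 'cV[R]_m)
    (k : nat) : set 'cV[R]_n -> \bar R :=
  match k with
  | 0%N => mu0
  | k'.+1 => fun A =>
      (\int[filter_distr mu0 y k']_u
         qkernel (y k) (filter_distr mu0 y k') u A)%E
  end.

(* The kernel q_{k+1} from time k to time k+1, which uses the datum y_{k+1}. *)
Definition filter_kernel (mu0 : set 'cV[R]_n -> \bar R) (y : nat -> 'cV[R]_m)
    (k : nat) : 'cV[R]_n -> set 'cV[R]_n -> \bar R :=
  qkernel (y k.+1) (filter_distr mu0 y k).

End filtering.

(* Main.v *)
Require Import Defs.
From HB Require Import structures.
From mathcomp Require Import all_boot all_order all_algebra.
From mathcomp Require Import all_classical all_reals all_analysis.
From mathcomp Require Import complex ring lra measurable_realfun.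

Set Implicit Arguments.
Unset Strict Implicit.
Unset Printing Implicit Defensive.

Import Order.TTheory GRing.Theory Num.Theory.
Import numFieldTopology.Exports numFieldNormedType.Exports.
Local Open Scope classical_set_scope.
Local Open Scope ring_scope.

(** The kernel q_{k+1}(u, dv) has Lebesgue density q0 / Z_{k+1}, so it suffices
    to bound q0 from below and Z_{k+1} from above, uniformly in u.

    Write L for an upper bound of |psi(u)|_Sigma^2, which exists since psi is
    bounded. From |a + b|^2 <= 2 (|a|^2 + |b|^2), applied to y - Hv and to
    v - psi(u), one gets
      q0(u, v) >= exp (- |y|_Gamma^2 - L) g(v)  with
      g(v) = exp (- |Hv|_Gamma^2 - |v|_Sigma^2)
    ([q0_ge]), and, dropping the data term,
      q0(u, v) <= exp(L) exp (- |v|_Sigma^2 / 4)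
    ([q0_le]). The right-hand side of the latter has a finite Lebesgue integral
    that depends neither on u nor on the data; as the filtering distribution is
    a probability measure, this bounds Z_{k+1} ([Zconst_le]). Hence one may take
    for Q the normalization of g(v) dv, and for epsilon_k a constant multiple of
    exp (- |y_{k+1}|_Gamma^2), which is a measurable function of the single
    datum y_{k+1}.

    Two facts need work. That exp (- |v|_Sigma^2 / 4) is integrable requires
    |v|_Sigma to dominate the Euclidean norm, hence the existence of a square
    root of Sigma: it is obtained from the complex spectral theorem as a real
    polynomial in Sigma ([psd_sqrt_exists]). That the filtering distributions
    are probability measures is proved by induction on k
    ([filter_distr_probability]), along with 0 < Z_{k+1} < +oo. *)

(** * Square roots of positive semi-definite matrices *)

Lemma poly_interpolation (F : fieldType) (f : F -> F) (s : seq F) :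
  exists p : {poly F}, forall x, x \in s -> p.[x] = f x.
Proof.
elim: s => [|a s [p ps]]; first by exists 0.
have [as_|as_] := boolP (a \in s).
  by exists p => x; rewrite inE => /orP[/eqP->|]; exact: ps.
pose w := \prod_(z <- s) ('X - z%:P).
have wa : w.[a] != 0 by rewrite -/(root _ _) root_prod_XsubC.
exists (p + ((f a - p.[a]) / w.[a]) *: w) => x.
rewrite inE => /predU1P[->|xs]; rewrite hornerD hornerZ.
  by rewrite divfK// addrC subrK.
suff /eqP -> : w.[x] == 0 by rewrite mulr0 addr0; exact: ps.
by rewrite -/(root _ _) root_prod_XsubC.
Qed.

Lemma trmx_horner_mx (F : comNzRingType) n (A : 'M[F]_n.+1) (p : {poly F}) :
  (horner_mx A p)^T = horner_mx A^T p.
Proof.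
elim/poly_ind: p => [|p c IH]; first by rewrite !rmorph0 trmx0.
rewrite [in RHS]mulrC !rmorphD !rmorphM /= !horner_mx_X !horner_mx_C.
by rewrite linearD/= tr_scalar_mx trmx_mul IH.
Qed.

Section psd_sqrt.
Context {R : realType}.

(** The squared Euclidean norm. *)
Definition sqn n (x : 'cV[R]_n) : R := \sum_(i < n) x i 0 ^+ 2.

Lemma sqn_ge0 n (x : 'cV[R]_n) : 0 <= sqn x.
Proof. by apply: sumr_ge0 => i _; exact: sqr_ge0. Qed.

Lemma sqn_gt0 n (x : 'cV[R]_n) : x != 0 -> 0 < sqn x.
Proof.
move=> x0; rewrite lt_def sqn_ge0 andbT; apply: contra x0.
rewrite psumr_eq0 => [/allP x0|i _]; last exact: sqr_ge0.
apply/eqP/colP => i; have := x0 i (mem_index_enum i).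
by rewrite /= sqrf_eq0 mxE => /eqP.
Qed.

Lemma trmx_mulE n (x : 'cV[R]_n) : (x^T *m x) 0 0 = sqn x.
Proof. by rewrite mxE; apply: eq_bigr => i _; rewrite mxE expr2. Qed.

Lemma eigenvalue_psd_ge0 n (S : 'M[R]_n) l :
  pos_semidef S -> eigenvalue S l -> 0 <= l.
Proof.
move=> [_ S0] /eigenvalueP[v vS v0].
have := S0 v^T; rewrite /quadratic trmxK vS -scalemxAl mxE.
rewrite -[in X in X *m v^T](trmxK v) trmx_mulE pmulr_lge0//.
by rewrite sqn_gt0// trmx_eq0.
Qed.

(** A symmetric positive semi-definite matrix is annihilated by every polynomial
    vanishing on its spectrum, which consists of nonnegative reals. The spectral
    theorem gives this over the complex numbers, and a polynomial identity in S
    can be checked after extension of scalars. *)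
Lemma psd_annihilator n (S : 'M[R]_n.+1) : pos_semidef S ->
  exists s : seq R, (forall l, l \in s -> 0 <= l) /\
    forall p : {poly R}, (forall l, l \in s -> p.[l] = 0) -> horner_mx S p = 0.
Proof.
move=> Spsd; have [Ssym _] := Spsd.
pose toC : {rmorphism R -> R[i]} := real_complex R.
pose A := map_mx toC S.
have Aherm : A \is hermsymmx.
  apply: realsym_hermsym.
    apply/is_hermitianmxP; rewrite expr0 scale1r map_mx_id// /A.
    by rewrite map_trmx Ssym.
  by apply/mxOverP => i j; rewrite mxE /= complex_real.
have /orthomx_spectralP := hermitian_normalmx Aherm.
have Dreal := hermitian_spectral_diag_real Aherm.
have Punit := spectral_unit A.
move: (spectralmx A) (spectral_diag A) Dreal Punit => P D Dreal Punit AE.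
(* The spectrum of a hermitian matrix is real, so D comes from R. *)
pose l j := complex.Re (D 0 j).
have lE j : D 0 j = toC (l j).
  by rewrite /toC/= RRe_real//; exact: (mxOverP Dreal).
exists [seq l j | j <- enum 'I_n.+1]; split.
  move=> _ /mapP[j _ ->]; apply: (@eigenvalue_psd_ge0 _ S) => //.
  rewrite eigenvalue_root_char -(fmorph_root toC) map_char_poly -/A.
  rewrite -eigenvalue_root_char -lE; apply/eigenvalueP; exists (row j P).
    rewrite AE -row_mul !mulmxA mulmxV// mul1mx row_mul row_diag_mx.
    by rewrite -scalemxAl -rowE.
  have : row_free P by rewrite row_free_unit.
  move=> /row_freeP[P' PP']; apply/eqP => rj0.
  have := congr1 (row j) PP'; rewrite row_mul rj0 mul0mx => /rowP/(_ j).
  by rewrite !mxE eqxx => /esym/eqP; rewrite oner_eq0.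
move=> p p0; apply: (map_mx_inj (f := toC)).
rewrite map_mx0 map_horner_mx -/A AE horner_mx_uconjC//.
rewrite horner_mx_diag.
suff -> : map_mx (horner (map_poly toC p)) D = 0.
  by rewrite [diag_mx 0]raddf0 mulmx0 mul0mx.
apply/rowP => j; rewrite !mxE lE horner_map p0 ?rmorph0//.
by apply: map_f; rewrite mem_enum.
Qed.

Lemma psd_sqrt_exists n (S : 'M[R]_n) : pos_semidef S ->
  exists B : 'M[R]_n, pos_semidef B /\ B *m B = S.
Proof.
case: n S => [|n] S Spsd.
  exists 0; rewrite [S]flatmx0 mulmx0; split => //; split.
    by rewrite trmx0.
  by move=> a; rewrite /quadratic mulmx0 mul0mx mxE.
have [Ssym _] := Spsd.
have [s [s0 sS]] := psd_annihilator Spsd.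
(* The root is B = C^2 with C = q(S) and q a fourth root on the spectrum: as C
   is symmetric, a^T B a = |C a|^2 >= 0. *)
have [q qs] := poly_interpolation (fun x => Num.sqrt (Num.sqrt x)) s.
pose C := horner_mx S q.
have CT : C^T = C by rewrite /C trmx_horner_mx Ssym.
exists (C *m C); split.
  split; first by rewrite trmx_mul CT.
  move=> a; rewrite /quadratic !mulmxA -{1}CT -trmx_mul -mulmxA trmx_mulE.
  exact: sqn_ge0.
have : horner_mx S (q ^+ 4 - 'X) = 0.
  apply: sS => l ls; rewrite hornerD hornerN hornerX horner_exp qs//.
  by rewrite (exprM _ 2 2) !sqr_sqrtr ?subrr ?sqrtr_ge0//; exact: s0.
rewrite rmorphB rmorphXn /= horner_mx_X => /eqP; rewrite subr_eq0 => /eqP <-.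
by rewrite -/C (exprM _ 2 2) !expr2.
Qed.

Lemma mxsqrtP n (S : 'M[R]_n) : pos_semidef S -> mxsqrt S *m mxsqrt S = S.
Proof.
by move=> /psd_sqrt_exists h; have := xgetPex 0 h; rewrite -/(mxsqrt S) => -[].
Qed.

Lemma pos_def_semidef n (S : 'M[R]_n) : pos_def S -> pos_semidef S.
Proof.
move=> [St S0]; split=> // a; have [->|a0] := eqVneq a 0; last exact/ltW/S0.
by rewrite /quadratic mulmx0 mxE.
Qed.

Lemma pos_def_unitmx n (S : 'M[R]_n) : pos_def S -> S \in unitmx.
Proof.
move=> [St S0]; rewrite -row_free_unit -kermx_eq0.
apply/negPn/negP => /rowV0Pn[v vk v0].
have vS : v *m S = 0 by apply/eqP; rewrite -sub_kermx.
have := S0 v^T; rewrite trmx_eq0 => /(_ v0).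
by rewrite /quadratic trmxK vS mul0mx mxE ltxx.
Qed.

Lemma mxsqrt_unitmx n (S : 'M[R]_n) : pos_def S -> mxsqrt S \in unitmx.
Proof.
move=> Spd; have := pos_def_unitmx Spd.
by rewrite -[S in S \in _]mxsqrtP ?unitmx_mul ?andbb//; exact: pos_def_semidef.
Qed.

Lemma pos_defZ n (S : 'M[R]_n) c : 0 < c -> pos_def S -> pos_def (c *: S).
Proof.
move=> c0 [St S0]; split; first by rewrite linearZ/= St.
move=> a /S0; rewrite /quadratic -scalemxAr -scalemxAl [X in _ -> 0 < X]mxE.
exact: mulr_gt0.
Qed.

End psd_sqrt.

(** * Weighted norms *)

Section euclid.
Context {R : realType}.

Lemma enorm_sqr n (x : 'cV[R]_n) : enorm x ^+ 2 = sqn x.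
Proof. by rewrite sqr_sqrtr// sqn_ge0. Qed.

Lemma mnorm_sqr n (S : 'M[R]_n) x :
  mnorm S x ^+ 2 = sqn (invmx (mxsqrt S) *m x).
Proof. exact: enorm_sqr. Qed.

Lemma sqnD_le n (x y : 'cV[R]_n) : sqn (x + y) <= 2 * (sqn x + sqn y).
Proof.
rewrite /sqn -big_split/= mulr_sumr; apply: ler_sum => i _.
rewrite mxE; have := sqr_ge0 (x i 0 - y i 0); lra.
Qed.

Lemma sqnN n (x : 'cV[R]_n) : sqn (- x) = sqn x.
Proof. by apply: eq_bigr => i _; rewrite mxE sqrrN. Qed.

Lemma sqn_mulmx_le m n (B : 'M[R]_(m, n)) :
  exists2 K, 0 < K & forall x, sqn (B *m x) <= K * sqn x.
Proof.
pose b := \sum_i \sum_j `|B i j|.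
exists (m%:R * b ^+ 2 + 1) => [|x].
  by rewrite ltr_wpDl// mulr_ge0// sqr_ge0.
suff : sqn (B *m x) <= m%:R * b ^+ 2 * sqn x by have := sqn_ge0 x; lra.
have xj j : `|x j 0| <= Num.sqrt (sqn x).
  rewrite -sqrtr_sqr ler_wsqrtr// /sqn (bigD1 j)//= lerDl.
  by apply: sumr_ge0 => i _; exact: sqr_ge0.
rewrite -[m in m%:R]card_ord -mulrA mulr_natl -sumr_const.
apply: ler_sum => i _; rewrite -(sqr_sqrtr (sqn_ge0 x)) -exprMn.
have b0 : 0 <= b by apply: sumr_ge0 => k _; apply: sumr_ge0.
apply: (@le_trans _ _ (`|(B *m x) i 0| ^+ 2)).
  by rewrite real_normK ?num_real.
rewrite lerXn2r ?nnegrE ?mulr_ge0 ?sqrtr_ge0// mxE.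
apply: (le_trans (ler_norm_sum _ _ _)).
apply: (@le_trans _ _ (\sum_j `|B i j| * Num.sqrt (sqn x))).
  by apply: ler_sum => j _; rewrite normrM ler_wpM2l.
rewrite -mulr_suml ler_wpM2r ?sqrtr_ge0// /b [leRHS](bigD1 i)//= lerDl.
by apply: sumr_ge0 => k _; apply: sumr_ge0.
Qed.

Lemma mnorm_sqr_le n (S : 'M[R]_n) :
  exists2 K, 0 < K & forall x, mnorm S x ^+ 2 <= K * sqn x.
Proof.
have [K K0 KS] := sqn_mulmx_le (invmx (mxsqrt S)).
by exists K => // x; rewrite mnorm_sqr.
Qed.

(** This is where the weight has to be positive definite: the root of S is then
    invertible, and x is its image of S^{-1/2} x. *)
Lemma mnorm_coercive n (S : 'M[R]_n) : pos_def S ->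
  exists2 K, 0 < K & forall x, sqn x <= K * mnorm S x ^+ 2.
Proof.
move=> /mxsqrt_unitmx Su; have [K K0 KS] := sqn_mulmx_le (mxsqrt S).
by exists K => // x; rewrite mnorm_sqr -{1}(mulKVmx Su x).
Qed.

Lemma mnorm_sqrD_le n (S : 'M[R]_n) x y :
  mnorm S (x + y) ^+ 2 <= 2 * (mnorm S x ^+ 2 + mnorm S y ^+ 2).
Proof. by rewrite !mnorm_sqr mulmxDr sqnD_le. Qed.

Lemma mnormN n (S : 'M[R]_n) x : mnorm S (- x) = mnorm S x.
Proof. by rewrite /mnorm mulmxN /enorm -/(sqn _) sqnN. Qed.

Lemma measurable_mulmx d (T : measurableType d) m n (B : 'M[R]_(m, n))
    (f : T -> 'cV[R]_n) :
  measurable_fun setT f -> measurable_fun setT (fun t => B *m f t).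
Proof.
move=> mf; apply: measurable_fun_mxP => i j; under eq_fun do rewrite mxE.
apply: measurable_sum => k; apply: measurable_funM => //.
exact: measurableT_comp (measurable_coord k j) mf.
Qed.

Lemma measurable_linear m n (H : {linear 'cV[R]_n -> 'cV[R]_m}) :
  measurable_fun setT H.
Proof.
pose B := \matrix_(i, j) H (delta_mx j 0) i 0.
rewrite (_ : H = (fun x => B *m x) :> (_ -> _)).
  exact: measurable_mulmx.
apply/funext => x; rewrite {1}(matrix_sum_delta x) linear_sum.
apply/colP => i; rewrite summxE mxE; apply: eq_bigr => j _.
by rewrite big_ord1 linearZ/= !mxE mulrC.
Qed.

Lemma measurable_mxB d (T : measurableType d) m n (f g : T -> 'M[R]_(m, n)) :
  measurable_fun setT f -> measurable_fun setT g ->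
  measurable_fun setT (fun t => f t - g t).
Proof.
move=> mf mg; apply: measurable_fun_mxP => i j; under eq_fun do rewrite !mxE.
by apply: measurable_funB; apply: measurableT_comp (measurable_coord i j) _.
Qed.

Lemma measurable_sqn d (T : measurableType d) n (f : T -> 'cV[R]_n) :
  measurable_fun setT f -> measurable_fun setT (fun t => sqn (f t)).
Proof.
move=> mf; apply: measurable_sum => i; apply: measurable_funX.
exact: measurableT_comp (measurable_coord i 0) mf.
Qed.

Lemma measurable_mnorm_sqr d (T : measurableType d) n (S : 'M[R]_n)
    (f : T -> 'cV[R]_n) :
  measurable_fun setT f -> measurable_fun setT (fun t => mnorm S (f t) ^+ 2).
Proof.
move=> mf; under eq_fun do rewrite mnorm_sqr.
exact/measurable_sqn/measurable_mulmx.
Qed.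

End euclid.

(** * Gaussian integrals with respect to Lebesgue measure *)

Section lebesgue.
Context {R : realType}.

Lemma lebesgue_cV_setT_gt0 n : (0 < @lebesgue_cV R n setT)%E.
Proof.
elim: n => [|n IH]; first by rewrite /= diracT lte01.
rewrite /= /lebesgue_cons /pushforward preimage_setT -setXTT.
rewrite product_measure1E//= mule_gt0//.
apply: (@lt_le_trans _ _ (lebesgue_measure `[0%R, 1%R]%classic : \bar R)).
  by rewrite lebesgue_measure_itv/= lte01 oppr0 adde0 lte01.
by apply: le_measure => //; rewrite inE.
Qed.

Lemma integral_lebesgue_cVS n (f : 'cV[R]_n.+1 -> \bar R) :
  measurable_fun setT f -> (forall x, 0 <= f x)%E ->
  (\int[lebesgue_cV n.+1]_x f x =
   \int[lebesgue_measure]_a \int[lebesgue_cV n]_v f (cons_cV (a, v)))%E.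
Proof.
move=> mf f0.
pose X : measurableType _ := (measurableTypeR R * 'cV[R]_n)%type.
have mc : measurable_fun (setT : set X) (@cons_cV R n).
  exact: measurable_cons_cV.
have mfc : measurable_fun (setT : set X) (f \o @cons_cV R n).
  exact: measurableT_comp.
pose mu : {measure set X -> \bar R} :=
  product_measure1 (@lebesgue_measure R) (lebesgue_cV n).
transitivity (\int[mu]_p (f \o @cons_cV R n) p)%E; last first.
  by rewrite fubini_tonelli1//= => p; exact: f0.
have := ge0_integral_pushforward mc mu measurableT mf.
by rewrite preimage_setT => <- // y _; exact: f0.
Qed.

Lemma integral_gauss1_lty (c : R) : 0 < c ->
  (\int[lebesgue_measure]_t (expR (- (c * t ^+ 2)))%:E < +oo :> \bar R)%E.
Proof.
move=> c0; pose s := Num.sqrt (2 * c)^-1.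
have s0 : s != 0 by rewrite gt_eqF// sqrtr_gt0 invr_gt0 mulr_gt0.
have := integral_normal_pdf (0 : R) s.
rewrite normal_pdfE//; under eq_integral do rewrite EFinM.
rewrite ge0_integralZl//=; last 3 first.
- by apply/measurable_EFinP; exact: measurable_normal_fun.
- by move=> x _; rewrite lee_fin normal_fun_ge0.
- by rewrite lee_fin normal_peak_ge0.
(* The integrand is the unnormalized density of N(0, 1 / (2 c)). *)
have -> : normal_fun 0 s = fun t => expR (- (c * t ^+ 2)) :> R.
  apply/funext => t; rewrite /normal_fun subr0 sqr_sqrtr; last first.
    by rewrite invr_ge0 mulr_ge0// ltW.
  congr expR; rewrite -mulr_natl; field; rewrite gt_eqF//.
have := normal_peak_gt0 s0.
case: (integral _ _ _) => [x| |] p0 //.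
- by rewrite ltry.
- by rewrite gt0_muley.
Qed.

Lemma integral_gauss_lty n (c : R) : 0 < c ->
  (\int[lebesgue_cV n]_v (expR (- (c * sqn v)))%:E < +oo)%E.
Proof.
move=> c0.
have mg k : measurable_fun setT (fun v : 'cV[R]_k => (expR (- (c * sqn v)))%:E).
  apply/measurable_EFinP/measurableT_comp => //; apply: measurableT_comp => //.
  by apply: measurable_funM => //; apply: measurable_sqn.
elim: n => [|n IH].
  by rewrite integral_dirac ?diracT ?mul1e ?ltry//; exact: mg.
rewrite integral_lebesgue_cVS; [|exact: mg|]; last first.
  by move=> x; rewrite lee_fin expR_ge0.
have E a (v : 'cV[R]_n) : (expR (- (c * sqn (cons_cV (a, v)))))%:E =
    ((expR (- (c * a ^+ 2)))%:E * (expR (- (c * sqn v)))%:E)%E.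
  rewrite -EFinM -expRD -opprD -mulrDr /sqn big_ord_recl mxE unlift_none/=.
  by under eq_bigr do rewrite mxE liftK/=.
under eq_integral => a _.
  under eq_integral do rewrite E.
  rewrite (ge0_integralZl _ measurableT (mg n)) ?lee_fin ?expR_ge0//.
  over.
rewrite ge0_integralZr//=.
- apply: lte_mul_pinfty; last exact: IH.
  + by apply: integral_ge0 => a _; rewrite lee_fin expR_ge0.
  + rewrite ge0_fin_numE; first exact: integral_gauss1_lty.
    by apply: integral_ge0 => a _; rewrite lee_fin expR_ge0.
- apply/measurable_EFinP/measurableT_comp => //; apply: measurableT_comp => //.
  by apply: measurable_funM => //; exact: measurable_funX.
- by apply: integral_ge0 => v _; rewrite lee_fin expR_ge0.
Qed.

End lebesgue.

(** * Densities and mixtures *)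

Section measure_constructions.
Local Open Scope ereal_scope.

Lemma integral_pos_gt0 d (T : measurableType d) (R : realType)
    (mu : {measure set T -> \bar R}) (g : T -> R) :
  0 < mu setT -> measurable_fun setT g -> (forall x, 0 < g x)%R ->
  0 < \int[mu]_x (g x)%:E.
Proof.
move=> muT mg g0; rewrite lt_neqAle integral_ge0 ?andbT => [|x _]; last first.
  by rewrite lee_fin ltW.
apply/eqP => /esym g00.
have [] := ae_eq_integral_abs mu measurableT (f := EFin \o g).
  exact/measurable_EFinP.
case=> [|N [mN N0 gN] _].
  by rewrite -[RHS]g00; apply: eq_integral => x _ /=; rewrite gtr0_norm.
move: muT; rewrite (_ : setT = N) ?N0 ?ltxx//.
apply/seteqP; split=> // x _; apply: gN => /= /(_ I) [] /eqP.
by rewrite gt_eqF.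
Qed.

(** The equality holds for all sets A, measurable or not, so that it determines
    the underlying set function. *)
Lemma density_measure d (T : measurableType d) (R : realType)
    (mu : {measure set T -> \bar R}) (f : T -> \bar R) :
  measurable_fun setT f -> (forall x, 0 <= f x) ->
  exists nu : {measure set T -> \bar R},
    forall A, nu A = \int[mu]_(x in A) f x.
Proof.
move=> mf f0; pose nu (A : set T) := \int[mu]_(x in A) f x.
have nu0 : nu set0 = 0 by exact: integral_set0.
have nu_ge0 A : 0 <= nu A by exact: integral_ge0.
have nu_sigma : semi_sigma_additive nu.
  move=> F mF tF mUF; rewrite /nu ge0_integral_bigcup//; last first.
    exact: measurable_funTS.
  by apply: is_cvg_ereal_nneg_natsum => i _; exact: integral_ge0.
pose nuM := isMeasure.Build _ _ _ nu nu0 nu_ge0 nu_sigma.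
pose nuP : {measure set T -> \bar R} := HB.pack nu nuM.
by exists nuP.
Qed.

(** The measure obtained by integrating the kernel k against mu; as above, the
    equality holds for all sets A. *)
Lemma mixture_measure d d' (T : measurableType d) (U : measurableType d')
    (R : realType) (mu : {measure set T -> \bar R})
    (k : T -> {measure set U -> \bar R}) :
  (forall A, measurable A -> measurable_fun setT (k ^~ A)) ->
  exists nu : {measure set U -> \bar R}, forall A, nu A = \int[mu]_x k x A.
Proof.
move=> mk; pose nu (A : set U) := \int[mu]_x k x A.
have nu0 : nu set0 = 0.
  by rewrite /nu; under eq_integral do rewrite measure0; exact: integral0.
have nu_ge0 A : 0 <= nu A by apply: integral_ge0 => x _; exact: measure_ge0.
have nu_sigma : semi_sigma_additive nu.
  move=> F mF tF mUF; rewrite /nu.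
  have -> : \int[mu]_x k x (\bigcup_i F i) =
      \int[mu]_x \sum_(i <oo) k x (F i).
    by apply: eq_integral => x _; rewrite measure_semi_bigcup.
  rewrite integral_nneseries//.
  - by apply: is_cvg_ereal_nneg_natsum => i _; exact: integral_ge0.
  - by move=> i; exact: mk.
pose nuM := isMeasure.Build _ _ _ nu nu0 nu_ge0 nu_sigma.
pose nuP : {measure set U -> \bar R} := HB.pack nu nuM.
by exists nuP.
Qed.

End measure_constructions.

(** * Bounds on the kernels of the filtering distributions *)

Section filter.
Context {R : realType} (n m : nat).
Variables (psi : 'cV[R]_n -> 'cV[R]_n) (H : {linear 'cV[R]_n -> 'cV[R]_m}).
Variables (Sigma : 'M[R]_n) (Gamma : 'M[R]_m).
Hypothesis psi_measurable : measurable_fun setT psi.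

Local Notation q0 := (q0 psi H Sigma Gamma).
Local Notation Zconst := (Zconst psi H Sigma Gamma).
Local Notation qkernel := (qkernel psi H Sigma Gamma).
Local Notation filter_distr := (filter_distr psi H Sigma Gamma).
Local Notation leb := (lebesgue_cV n).

Lemma q0_gt0 y u v : 0 < q0 y u v.
Proof. exact: expR_gt0. Qed.

Lemma measurable_q0 y :
  measurable_fun setT (fun p : 'cV[R]_n * 'cV[R]_n => q0 y p.1 p.2).
Proof.
apply: measurableT_comp => //; apply: measurable_funB.
  apply: measurableT_comp => //; apply: measurable_funM => //.
  apply/measurable_mnorm_sqr/measurable_mxB => //.
  exact: measurableT_comp (measurable_linear H) measurable_snd.
apply: measurable_funM => //; apply/measurable_mnorm_sqr/measurable_mxB => //.
exact: measurableT_comp psi_measurable measurable_fst.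
Qed.

Lemma measurable_q0r y u : measurable_fun setT (fun v => (q0 y u v)%:E).
Proof.
apply/measurable_EFinP.
exact: measurableT_comp (measurable_q0 y) (pair1_measurable u).
Qed.

Lemma measurable_int_q0 y A : measurable A ->
  measurable_fun setT (fun u => \int[leb]_(v in A) (q0 y u v)%:E)%E.
Proof.
move=> mA; under eq_fun do rewrite integral_mkcond.
pose f (p : 'cV[R]_n * 'cV[R]_n) : \bar R :=
  ((fun p => (q0 y p.1 p.2)%:E) \_ (setT `*` A)) p.
have f0 p : (0 <= f p)%E.
  by rewrite /f patchE; case: ifP => // _; rewrite lee_fin ltW ?q0_gt0.
have mf : measurable_fun setT f.
  apply/(measurable_restrictT _ _).1; first exact: measurableX.
  by apply: measurable_funTS; apply/measurable_EFinP; exact: measurable_q0.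
have := measurable_fun_fubini_tonelli_F (m2 := leb) f mf f0.
rewrite /fubini_F; congr measurable_fun; apply/funext => u.
apply: eq_integral => v _; rewrite /f !patchE.
by rewrite in_setX in_setT.
Qed.

(** Up to a positive factor independent of u and v, a lower bound of q0. *)
Definition gauss_minorant (v : 'cV[R]_n) : R :=
  expR (- mnorm Gamma (H v) ^+ 2 - mnorm Sigma v ^+ 2).

(** Up to a factor independent of u, v and the datum y, an upper bound of q0. *)
Definition gauss_majorant (v : 'cV[R]_n) : R :=
  expR (- (4^-1 * mnorm Sigma v ^+ 2)).

Lemma measurable_gauss_minorant : measurable_fun setT gauss_minorant.
Proof.
apply: measurableT_comp => //; apply: measurable_funB.
  apply: measurableT_comp => //; apply: measurable_mnorm_sqr.
  exact: measurable_linear.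
exact/measurable_mnorm_sqr/measurable_id.
Qed.

Lemma measurable_gauss_majorant : measurable_fun setT gauss_majorant.
Proof.
apply: measurableT_comp => //; apply: measurableT_comp => //.
by apply: measurable_funM => //; exact/measurable_mnorm_sqr/measurable_id.
Qed.

Lemma integral_gauss_majorant_lty : pos_def Sigma ->
  (\int[leb]_v (gauss_majorant v)%:E < +oo)%E.
Proof.
move=> /mnorm_coercive[K K0 KS].
apply: (@le_lt_trans _ _
  (\int[leb]_v (expR (- ((4 * K)^-1 * sqn v)))%:E)%E); last first.
  by apply: integral_gauss_lty; rewrite invr_gt0 mulr_gt0.
apply: ge0_le_integral => //.
- by move=> v _; rewrite lee_fin expR_ge0.
- by apply/measurable_EFinP; exact: measurable_gauss_majorant.
- apply/measurable_EFinP/measurableT_comp => //; apply: measurableT_comp => //.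
  by apply: measurable_funM => //; apply: measurable_sqn.
move=> v _; rewrite lee_fin ler_expR lerN2 invfM -mulrA ler_pM2l//.
by rewrite ler_pdivrMl.
Qed.

Lemma gauss_minorant_le_majorant v : gauss_minorant v <= gauss_majorant v.
Proof.
rewrite ler_expR; have := sqr_ge0 (mnorm Gamma (H v)).
have := sqr_ge0 (mnorm Sigma v); lra.
Qed.

Lemma q0_le L y u v : mnorm Sigma (psi u) ^+ 2 <= L ->
  q0 y u v <= expR L * gauss_majorant v.
Proof.
move=> psiL; rewrite -expRD ler_expR.
have := mnorm_sqrD_le Sigma (v - psi u) (psi u); rewrite subrK.
have := sqr_ge0 (mnorm Gamma (y - H v)); have := sqr_ge0 (mnorm Sigma (psi u)).
lra.
Qed.

Lemma q0_ge L y u v : mnorm Sigma (psi u) ^+ 2 <= L ->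
  expR (- mnorm Gamma y ^+ 2 - L) * gauss_minorant v <= q0 y u v.
Proof.
move=> psiL; rewrite -expRD ler_expR.
have := mnorm_sqrD_le Sigma v (- psi u); have := mnorm_sqrD_le Gamma y (- H v).
rewrite !mnormN; lra.
Qed.

Section bounds.
Variable L : R.
Hypothesis psiL : forall u, mnorm Sigma (psi u) ^+ 2 <= L.
Hypothesis Sigma_pos : pos_def Sigma.

Let Gsup := (\int[leb]_v (gauss_majorant v)%:E)%E.

Lemma int_q0_ge y u A : measurable A ->
  ((expR (- mnorm Gamma y ^+ 2 - L))%:E *
     \int[leb]_(v in A) (gauss_minorant v)%:E <=
   \int[leb]_(v in A) (q0 y u v)%:E)%E.
Proof.
move=> mA; have mg : measurable_fun A (EFin \o gauss_minorant).
  by apply/measurable_funTS/measurable_EFinP; exact: measurable_gauss_minorant.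
rewrite -ge0_integralZl//; last by move=> v _; rewrite lee_fin expR_ge0.
apply: ge0_le_integral => //.
- by move=> v _; rewrite -EFinM lee_fin mulr_ge0// expR_ge0.
- exact: measurable_funeM.
- by apply: measurable_funTS; exact: measurable_q0r.
- by move=> v _; rewrite -EFinM lee_fin q0_ge.
Qed.

Lemma int_q0_le y u : (\int[leb]_v (q0 y u v)%:E <= (expR L)%:E * Gsup)%E.
Proof.
have mg : measurable_fun setT (EFin \o gauss_majorant).
  by apply/measurable_EFinP; exact: measurable_gauss_majorant.
rewrite -ge0_integralZl//; last by move=> v _; rewrite lee_fin expR_ge0.
apply: ge0_le_integral => //.
- by move=> v _; rewrite lee_fin ltW// q0_gt0.
- exact: measurable_q0r.
- exact: measurable_funeM.
- by move=> v _; rewrite -EFinM lee_fin q0_le.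
Qed.

Lemma Zconst_le y (P : probability 'cV[R]_n R) :
  (Zconst y P <= (expR L)%:E * Gsup)%E.
Proof.
rewrite -[leRHS]mule1 -(probability_setT P) -integral_cst//.
apply: ge0_le_integral => //.
- by move=> u _; apply: integral_ge0 => v _; rewrite lee_fin ltW// q0_gt0.
- exact: measurable_int_q0.
- by move=> u _; exact: int_q0_le.
Qed.

Lemma Zconst_gt0 y (P : probability 'cV[R]_n R) : (0 < Zconst y P)%E.
Proof.
pose c := ((expR (- mnorm Gamma y ^+ 2 - L))%:E *
  \int[leb]_v (gauss_minorant v)%:E)%E.
have c0 : (0 < c)%E.
  rewrite mule_gt0 ?lte_fin ?expR_gt0//; apply: integral_pos_gt0.
  - exact: lebesgue_cV_setT_gt0.
  - exact: measurable_gauss_minorant.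
  - by move=> v; exact: expR_gt0.
apply: (lt_le_trans c0).
rewrite -[leLHS]mule1 -(probability_setT P) -integral_cst//.
apply: ge0_le_integral => //.
- by move=> u _; exact: ltW.
- exact: measurable_int_q0.
- by move=> u _; exact: int_q0_ge.
Qed.

Lemma Zconst_fin y (P : probability 'cV[R]_n R) :
  exists2 z, 0 < z & Zconst y P = z%:E.
Proof.
have Z0 := Zconst_gt0 y P; have : (Zconst y P < +oo)%E.
  apply: (le_lt_trans (Zconst_le y P)); apply: lte_mul_pinfty => //.
  exact: integral_gauss_majorant_lty.
case: (Zconst y P) Z0 => [z| |]//; rewrite lte_fin => z0 _.
by exists z.
Qed.

(** One step of the filter sends a probability measure to a probability measure:
    the total mass of the image is Z / Z, where Z is neither 0 nor +oo. *)
Lemma filter_step y (P : probability 'cV[R]_n R) :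
  exists P' : probability 'cV[R]_n R,
    forall A, P' A = (\int[P]_u qkernel y P u A)%E.
Proof.
have [z z0 zE] := Zconst_fin y P.
have zi0 : 0 <= z^-1 by rewrite invr_ge0 ltW.
have kex u : exists nu : {measure set 'cV[R]_n -> \bar R},
    forall A, nu A = qkernel y P u A.
  have [nu nuE] := density_measure leb (measurable_q0r y u)
    (fun v => ltW (q0_gt0 y u v)).
  exists (mscale (NngNum zi0) nu) => A.
  by rewrite /qkernel zE inver gt_eqF// -nuE.
have [k kE] := choice kex.
have mk A : measurable A -> measurable_fun setT (k ^~ A).
  move=> mA; under eq_fun do rewrite kE.
  by apply: measurable_funeM; exact: measurable_int_q0.
have [nu nuE] := mixture_measure P mk.
have nuE' A : nu A = (\int[P]_u qkernel y P u A)%E.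
  by rewrite nuE; apply: eq_integral => u _; rewrite kE.
have nuT : nu setT = 1%E.
  rewrite nuE' ge0_integralZl//.
  - rewrite -/(Zconst y P) zE inver gt_eqF// -EFinM mulVf// gt_eqF//.
  - exact: measurable_int_q0.
  - by move=> u _; apply: integral_ge0 => v _; rewrite lee_fin ltW// q0_gt0.
  - by rewrite inve_ge0 zE lee_fin ltW.
(* As nu has mass 1, it equals its normalization, which is a probability. *)
exists (mnormalize nu P) => A.
by rewrite /= /mnormalize nuT onee_eq0/= invr1 mule1 nuE'.
Qed.

Lemma filter_distr_probability (mu0 : probability 'cV[R]_n R) y k :
  exists P : probability 'cV[R]_n R,
    filter_distr mu0 y k = P :> (set 'cV[R]_n -> \bar R).
Proof.
elim: k => [|k [P PE]]; first by exists mu0.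
have [P' P'E] := filter_step (y k.+1) P; exists P'.
by apply/funext => A; rewrite P'E /= PE.
Qed.

(** The minorization, before normalization of the minorizing measure. *)
Lemma qkernel_ge (P : probability 'cV[R]_n R) y u A : measurable A ->
  (((expR L * fine Gsup)^-1 * expR (- mnorm Gamma y ^+ 2 - L))%:E *
     \int[leb]_(v in A) (gauss_minorant v)%:E <= qkernel y P u A)%E.
Proof.
move=> mA; have [z z0 zE] := Zconst_fin y P.
have Gfin : Gsup \is a fin_num.
  rewrite ge0_fin_numE; first exact: integral_gauss_majorant_lty.
  by apply: integral_ge0 => v _; rewrite lee_fin expR_ge0.
have := Zconst_le y P; rewrite zE -(fineK Gfin) -EFinM lee_fin => zle.
rewrite /qkernel zE inver gt_eqF// EFinM -muleA.
apply: lee_pmul.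
- by rewrite lee_fin invr_ge0 (le_trans _ zle)// ltW.
- rewrite mule_ge0 ?lee_fin ?expR_ge0//.
  by apply: integral_ge0 => v _; rewrite lee_fin expR_ge0.
- by rewrite lee_fin lef_pV2// posrE (lt_le_trans z0).
- exact: int_q0_ge.
Qed.

End bounds.

End filter.

Unset Implicit Arguments.

Theorem theorem2p4 (R : realType) (n m : nat)
  (psi : 'cV[R]_n -> 'cV[R]_n)
  (psi_measurable : measurable_fun setT psi)
  (psi_bounded : exists M : R, forall u, enorm (psi u) <= M)
  (H : {linear 'cV[R]_n -> 'cV[R]_m})
  (mu0 : probability 'cV[R]_n R)
  (sigma gamma r : R) (sigma_gt0 : 0 < sigma) (gamma_gt0 : 0 < gamma)
  (r_def : r = sigma / gamma)
  (Sigma0 Sigma : 'M[R]_n) (Sigma0_pos : pos_def Sigma0)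
  (Sigma_def : Sigma = sigma ^+ 2 *: Sigma0)
  (Gamma0 Gamma : 'M[R]_m) (Gamma0_pos : pos_def Gamma0)
  (Gamma_def : Gamma = gamma ^+ 2 *: Gamma0)
  (udag0 : 'cV[R]_n)
  (Sigmastar : 'M[R]_n) (Sigmastar_psd : pos_semidef Sigmastar)
  (Gammastar : 'M[R]_m) (Gammastar_psd : pos_semidef Gammastar)
  (d : measure_display) (Omega : measurableType d) (P : probability Omega R)
  (xidag : nat -> Omega -> 'cV[R]_n) (etadag : nat -> Omega -> 'cV[R]_m)
  (xidag_iid : iid_centered_normal P xidag Sigmastar)
  (etadag_iid : iid_centered_normal P (fun k => etadag k.+1) Gammastar)
  (noise_indep :
    independent2 P (sigma_seq xidag) (sigma_seq (fun k => etadag k.+1)))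
  (udag : nat -> Omega -> 'cV[R]_n) (ydag : nat -> Omega -> 'cV[R]_m)
  (udag_init : forall w, udag 0%N w = udag0)
  (udag_step : forall k w,
    udag k.+1 w = psi (udag k w) + (r * gamma) *: xidag k w)
  (ydag_step : forall k w,
    ydag k.+1 w = H (udag k.+1 w) + gamma *: etadag k.+1 w) :
  exists (Q : probability 'cV[R]_n R) (eps : nat -> Omega -> R),
    [/\ forall k, sigma_rv (eps k) `<=` sigma_seq (fun j => ydag j.+1),
        forall k w, 0 < eps k w &
        forall w k u (A : set 'cV[R]_n), measurable A ->
          ((eps k w)%:E * Q A <=
           filter_kernel psi H Sigma Gamma mu0 (fun j => ydag j w) k u A)%E].
Proof.
have Sigma_pos : pos_def Sigma.
  by rewrite Sigma_def; apply/pos_defZ/Sigma0_pos/exprn_gt0.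
have [M psiM] := psi_bounded.
have [K K0 normK] := mnorm_sqr_le Sigma.
pose L := K * M ^+ 2.
have psiL u : mnorm Sigma (psi u) ^+ 2 <= L.
  apply: (le_trans (normK _)); rewrite ler_pM2l// -enorm_sqr.
  by rewrite lerXn2r// ?nnegrE ?(le_trans _ (psiM u))// sqrtr_ge0.
pose g := gauss_minorant H Sigma Gamma.
have mg : measurable_fun setT (EFin \o g).
  by apply/measurable_EFinP; exact: measurable_gauss_minorant.
have g0 v : (0 <= (EFin \o g) v)%E by rewrite lee_fin expR_ge0.
have [nu nuE] := density_measure (lebesgue_cV n) mg g0.
have nu_gt0 : (0 < nu setT)%E.
  rewrite nuE; apply: integral_pos_gt0; first exact: lebesgue_cV_setT_gt0.
    exact: measurable_gauss_minorant.
  by move=> v; exact: expR_gt0.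
pose Gsup := (\int[lebesgue_cV n]_v (gauss_majorant Sigma v)%:E)%E.
have Gsup_lty : (Gsup < +oo)%E by exact: integral_gauss_majorant_lty.
have nu_le : (nu setT <= Gsup)%E.
  rewrite nuE; apply: ge0_le_integral => //.
  - by apply/measurable_EFinP; exact: measurable_gauss_majorant.
  - by move=> v _; rewrite lee_fin gauss_minorant_le_majorant.
have nu_lty := le_lt_trans nu_le Gsup_lty.
pose a := fine (nu setT).
have a0 : 0 < a by rewrite fine_gt0// nu_gt0.
have G0 : 0 < fine Gsup by rewrite fine_gt0// Gsup_lty (lt_le_trans nu_gt0).
(* The lower bound as a function of the datum; the factor a compensates for the
   normalization of nu. *)
pose h (y : 'cV[R]_m) : R :=
  (expR L * fine Gsup)^-1 * expR (- mnorm Gamma y ^+ 2 - L) * a.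
have mh : measurable_fun setT h.
  apply: measurable_funM => //; apply: measurable_funM => //.
  apply: measurableT_comp => //; apply: measurable_funB => //.
  by apply: measurableT_comp => //; apply: measurable_mnorm_sqr.
(* The argument mu0 of mnormalize is only a default value, irrelevant here since
   0 < nu setT < +oo. *)
exists (mnormalize nu mu0), (fun k w => h (ydag k.+1 w)); split.
- move=> k _ [B mB <-]; apply: sub_sigma_algebra; exists k => //.
  exists (h @^-1` B) => //; rewrite -[X in measurable X]setTI; exact: mh.
- by move=> k w; rewrite !mulr_gt0 ?invr_gt0 ?mulr_gt0 ?expR_gt0.
move=> w k u A mA; rewrite /filter_kernel.
have [mu ->] := filter_distr_probability H Gamma psi_measurable psiL Sigma_pos
  mu0 (fun j => ydag j w) k.
have := qkernel_ge H Gamma psi_measurable psiL Sigma_pos mu (ydag k.+1 w) u mA.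
apply: le_trans; rewrite -[X in (_ <= _ * X)%E](nuE A) /= /mnormalize.
rewrite gt_eqF// lt_eqF//= -/a muleCA -EFinM /h mulfK ?gt_eqF// muleC.
exact: lexx.
Qed.
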